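(* For every graph $G=(V,E)$ and every finite-dimensional normed space $X$, the set $$\ell(G,X):=\{p\in[1,\infty] : G \text{ is } (X,\ell_p)\text{-flattenable}\}$$ is a closed subset of $[1,\infty]$.
   Context: All normed spaces are real and have dimension greater than zero. A graph $G=(V,E)$ is finite and simple with at least one edge. The measurement map of $(G,X)$ is $f_{G,X}:X^V\to\mathbb{R}^E$, $(x_v)_{v\in V}\mapsto(\|x_v-x_w\|_X)_{vw\in E}$. The graph $G$ is $(X,Y)$-flattenable if $f_{G,X}(X^V)\supseteq f_{G,Y}(Y^V)$. Here $\ell_p$ ($p\in[1,\infty]$) denotes the real sequence space $\ell_p(\mathbb{N})$ with its usual norm $\|\cdot\|_p$. The set $[1,\infty]$ carries its usual (extended real line) topology, in which a sequence diverging to infinity converges to $\infty$. *)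

(* Defs.v *)
From HB Require Import structures.
From mathcomp Require Import all_boot all_order all_algebra.
From mathcomp Require Import all_classical all_reals all_analysis.
From mathcomp Require Import ess_sup_inf.

Set Implicit Arguments.
Unset Strict Implicit.
Unset Printing Implicit Defensive.
Import Order.TTheory GRing.Theory Num.Theory.
Import numFieldNormedType.Exports.

Local Open Scope classical_set_scope.
Local Open Scope ring_scope.

Record graph := Graph {
  vertex :> finType;
  adj : rel vertex;
  adj_sym : symmetric adj;
  adj_irrefl : irreflexive adj;
  adj_nonempty : exists v w, adj v w }.

(* An unordered edge vw is represented by exactly one ordered pair, the one
   listing its endpoints in the enumeration order of the vertices. *)
Definition is_edge (G : graph) (e : G * G) : bool :=
  adj e.1 e.2 && (enum_rank e.1 < enum_rank e.2)%N.

Definition edge (G : graph) := {e : G * G | is_edge e}.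

Section measurement.
Variables (R : realType) (G : graph).

Definition measurement (X : normedModType R) (x : G -> X) : edge G -> R :=
  fun e => `|x (val e).1 - x (val e).2|.

Definition flattenable (X Y : normedModType R) :=
  range (@measurement Y) `<=` range (@measurement X).

Lemma flattenableP (X Y : normedModType R) :
  flattenable X Y <->
  forall y : G -> Y, exists x : G -> X,
    forall v w, adj v w -> `|x v - x w| = `|y v - y w|.
Proof.
split=> [fXY y|fXY _ [y _ <-]]; last first.
  have [x xy] := fXY y; exists x => //.
  apply/funext => -[[v w] e]; apply: xy.
  by have /andP[] := e.
have /fXY[x _ xy] : range (@measurement Y) (measurement y) by exists y.
exists x => v w vw; have vNw : v != w.
  by apply: contraTneq vw => ->; rewrite adj_irrefl.
have : enum_rank v != enum_rank w :> nat.
  by rewrite (inj_eq val_inj) (inj_eq enum_rank_inj).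
rewrite neq_ltn => /orP[lt_vw|lt_wv].
  have e : is_edge (v, w) by rewrite /is_edge vw.
  by have := congr1 (@^~ (exist _ (v, w) e)) xy.
have e : is_edge (w, v) by rewrite /is_edge adj_sym vw.
rewrite distrC [RHS]distrC.
by have := congr1 (@^~ (exist _ (w, v) e)) xy.
Qed.

End measurement.

(* Normed spaces are nonzero by convention, hence n > 0. *)
Definition finite_dimensional (R : realType) (X : normedModType R) :=
  exists n : nat, (0 < n)%N /\
  exists f : {linear X -> 'rV[R]_n}, bijective f.

Lemma ae_counting (R : realType) (P : nat -> Prop) :
  (\forall k \ae (@counting nat R), P k) -> forall k, P k.
Proof.
move=> [A [_ A0 PA]] k; apply: contrapT => Pk.
have : (@counting nat R [set k] <= @counting nat R A)%E.
  by apply: le_measure; rewrite ?inE// => _ ->; exact: PA.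
rewrite [leRHS]A0 leNgt /counting asboolT ?fset_set1 ?finite_set1//.
by rewrite finmap.cardfs1 lte01.
Qed.

Section lp.
Variables (R : realType) (p : \bar R) (p1 : (1 <= p)%E).

(* l_p(N) is the space of p-integrable functions for the counting measure on
   nat. Every function on nat is measurable and no nonempty set is negligible,
   so no quotient is needed for its norm to be definite. *)
Definition lp := LfunType (@counting nat R) p1.

HB.instance Definition _ := GRing.Lmodule.on lp.

Definition lp_norm (x : lp) : R := fine ('N[@counting nat R]_p [EFin \o x])%E.

Lemma lp_normD (x y : lp) : lp_norm (x + y) <= lp_norm x + lp_norm y.
Proof. exact: ler_LnormD. Qed.

Lemma lp_normZ (a : R) (x : lp) : lp_norm (a *: x) = `|a| * lp_norm x.
Proof.
by apply: EFin_inj; rewrite EFinM !finite_norm_fine; exact: LnormZ.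
Qed.

Lemma lp_norm_eq0 (x : lp) : lp_norm x = 0 -> x = 0.
Proof.
move=> /fine_Lnormr_eq0 x0; apply/LfuneqP => k.
exact: (ae_counting x0).
Qed.

HB.instance Definition _ :=
  @Lmodule_isNormed.Build R lp lp_norm lp_normD lp_normZ lp_norm_eq0.

End lp.

Section lp_theory.
Variable R : realType.

Lemma mem_lp (p : \bar R) (p1 : (1 <= p)%E) (u : nat -> R) :
  ('N[@counting nat R]_p [EFin \o u] < +oo)%E -> exists x : lp p1, x =1 u.
Proof.
move=> ufin; have uL : u \in Lfun (@counting nat R) p.
  by rewrite inE; apply/andP; split; rewrite inE.
by exists (Lfun_Sub p1 uL).
Qed.

Lemma lp_norm_fin (r : R) (r1 : (1 <= r%:E)%E) (x : lp r1) :
  (`|x|%:E = (\sum_(k <oo) (`|x k| `^ r)%:E) `^ r^-1)%E.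
Proof.
rewrite [LHS]finite_norm_fine Lnorm_counting //.
by rewrite (lt_le_trans ltr01).
Qed.

Lemma lp_norm_pinfty (p1 : (1 <= +oo :> \bar R)%E) (x : lp p1) :
  (`|x|%:E = ereal_sup (range (fun k => `|x k|%:E)))%E.
Proof.
rewrite [LHS]finite_norm_fine unlock ifT; last first.
  rewrite lt_neqAle measure_ge0 andbT; apply/eqP => c0.
  suff : (0 < 0 :> \bar R)%E by rewrite ltxx.
  by rewrite {2}c0 /= /counting asboolF//; exact: infinite_nat.
apply/eqP; rewrite eq_le; apply/andP; split.
  apply/ess_supP/nearW => k; exact: ereal_sup_ubound.
apply: ge_ereal_sup => _ [k _ <-].
exact: (ae_counting (ess_sup_ge _ (fun k => `|x k|%:E)%E)).
Qed.

End lp_theory.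

Definition exponents (R : realType) : set (\bar R) := [set p | (1 <= p)%E].
Arguments exponents : clear implicits.

Definition flattenable_exponents (R : realType) (G : graph)
    (X : normedModType R) : set (\bar R) :=
  [set p | exists p1 : (1 <= p)%E, flattenable G X (lp p1)].

(* Main.v *)
From HB Require Import structures.
Require Import Defs.
From mathcomp Require Import all_boot all_order all_algebra.
From mathcomp Require Import all_classical all_reals all_analysis.
From mathcomp Require Import ess_sup_inf.

(** Let [p] be adherent to the set of exponents, and let [y] map the vertices
    to [l_p]. For a fixed error [e], it is enough to find one good exponent and
    one placement of the vertices in [X] that realizes the edge lengths of [y]
    up to [e].

    Cut every [y v] off after its first [n] coordinates. The [l_p] norm of the
    cut-off of a vector tends to the norm of that vector as [n] grows, also
    for [p = +oo] since a supremum is a limit of finite maxima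
    ([cvg_trunc_norm]). There are finitely many pairs of vertices, so a single
    [n] serves them all. This step does not approximate [y] itself, whose cut-offs need
    not converge to [y] in [l_oo]; only the lengths matter. Once [n] is fixed,
    the cut-offs lie in every [l_q], and their [l_q] norms, which are explicit
    functions of [n] numbers, depend continuously on [q]
    ([cvg_trunc_norm_exponent]). An exponent [q] close to [p] for which [G] is
    [(X, l_q)]-flattenable then provides the placement.

    Passing to the limit [e -> 0] uses compactness: the realizable length
    functions form a closed set because, after translating each connected
    component to the origin, the approximate placements stay in a power of a
    ball of [X], which is compact as [X] has finite dimension
    ([distance_realization], [finite_dimensional_compact_ball]). *)

Set Implicit Arguments.
Unset Strict Implicit.
Unset Printing Implicit Defensive.
Import Order.TTheory GRing.Theory Num.Theory.
Import numFieldNormedType.Exports.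

Local Open Scope classical_set_scope.
Local Open Scope ring_scope.

(** * Compactness of balls in finite dimension *)

Section finite_dimension.
Variables (R : realType) (X : normedModType R).

Lemma linear_rV_continuous n (g : {linear 'rV[R]_n -> X}) : continuous g.
Proof.
have -> : (g : _ -> _) = fun u => \sum_(i < n) u ord0 i *: g (delta_mx ord0 i).
  apply/funext => u; rewrite {1}(row_sum_delta u) linear_sum.
  by apply: eq_bigr => i _; rewrite linearZ.
apply: (@continuous_big X _ +%R 0 xpredT _ 'rV[R]_n) => [|i _ u].
  exact: add_continuous.
exact: (cvgZr_tmp (@coord_continuous R 1 n ord0 i u)).
Qed.

(** The minimum of [`|g u|] on the compact unit sphere is positive, and scaling
    carries the bound from the sphere to the whole space. *)
Lemma linear_inj_norm_ge n (g : {linear 'rV[R]_n -> X}) : injective g ->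
  exists2 m, 0 < m & forall u, m * `|u| <= `|g u|.
Proof.
move=> g_inj.
(* In dimension 0 the unit sphere is empty and has no minimum. *)
have [[u0 u0N0]|no_u] := pselect (exists u : 'rV[R]_n, u != 0); last first.
  exists 1 => // u; suff -> : u = 0 by rewrite normr0 mulr0.
  by have [|uN0] := eqVneq u 0; last by case: no_u; exists u.
pose S := [set u : 'rV[R]_n | `|u| = 1].
have Sscale (u : 'rV[R]_n) : u != 0 -> S (`|u|^-1 *: u).
  by move=> uN0; rewrite /S /= normrZ normfV normr_id mulVf// normr_eq0.
have S0 : S !=set0 by exists (`|u0|^-1 *: u0); exact: Sscale.
have Scompact : compact S.
  apply: bounded_closed_compact.
    by exists 1; split => // M M1 u /= ->; exact: ltW.
  have -> : S = (fun u => `|u|) @^-1` [set 1] by [].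
  apply: preimage_closed => [u _|]; last exact: closed_eq.
  exact: norm_continuous.
have [|c Sc cmin] := @compact_EVT_min _ R (fun u => `|g u|) S S0 Scompact.
  apply: continuous_subspaceT => u.
  apply: (@continuous_comp _ _ _ g); last exact: norm_continuous.
  exact: linear_rV_continuous.
exists `|g c|.
  rewrite normr_gt0; apply: contraTN Sc => /eqP gc0.
  rewrite notin_setE /S /= => c1.
  have c0 : c = 0 by apply: g_inj; rewrite gc0 linear0.
  by move: c1; rewrite c0 normr0 => /esym/eqP; rewrite oner_eq0.
move=> u; have [->|uN0] := eqVneq u 0; first by rewrite normr0 mulr0.
have := cmin _ (mem_set (Sscale u uN0)).
by rewrite linearZ normrZ normfV normr_id ler_pdivlMl ?normr_gt0// mulrC.
Qed.

(** The inverse [g] of the coordinate map is continuous, so the coordinate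
    vectors of a ball form a closed set; they are bounded by
    [linear_inj_norm_ge], hence compact, and [g] maps them onto the ball. *)
Lemma finite_dimensional_compact_ball (r : R) :
  finite_dimensional X -> compact [set x : X | `|x| <= r].
Proof.
move=> [n [_ [f [g fK gK]]]].
have g_lin : linear g.
  by move=> a u v; apply: (can_inj fK); rewrite linearP !gK.
pose gL : {linear 'rV[R]_n -> X} :=
  HB.pack g (GRing.isLinear.Build _ _ _ _ g g_lin).
have g_cont : continuous gL by exact: linear_rV_continuous.
have [m m0 gm] : exists2 m, 0 < m & forall u, m * `|u| <= `|gL u|.
  exact/linear_inj_norm_ge/(can_inj gK).
have -> : [set x : X | `|x| <= r] = gL @` [set u | `|gL u| <= r].
  apply/seteqP; split=> [x xr|_ [u ur <-]//].
  by exists (f x) => //=; rewrite fK.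
apply: continuous_compact.
  exact: continuous_subspaceT.
apply: bounded_closed_compact.
  exists (r / m); split=> [|M rM u /= ur]; first exact: num_real.
  apply/ltW; apply: le_lt_trans rM.
  by rewrite ler_pdivlMr// mulrC; exact: le_trans (gm u) ur.
apply: (@preimage_closed _ _ (fun u => `|gL u|) [set t | t <= r]); last first.
  exact: closed_le.
move=> u _.
by apply: (@continuous_comp _ _ _ gL); [exact: g_cont|exact: norm_continuous].
Qed.

End finite_dimension.

(** * Realizing prescribed edge lengths *)

Section distance_realization.
Variables (R : realType) (X : normedModType R) (T : finType) (e : rel T).

Lemma path_dist_le (x : T -> X) (D : R) v p :
  (forall a b, e a b -> `|x a - x b| <= D) -> path e v p ->
  `|x v - x (last v p)| <= (size p)%:R * D.
Proof.
move=> xD; elim: p v => [|w p IHp] v /=; first by rewrite subrr normr0 mul0r.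
move=> /andP[vw wp].
rewrite -(subrKA (x w)) -natr1 mulrDl mul1r [leRHS]addrC.
apply: le_trans (ler_normD _ _) _; apply: lerD; [exact: xD|exact: IHp].
Qed.

Lemma connect_dist_le (x : T -> X) (D : R) v w : 0 <= D ->
  (forall a b, e a b -> `|x a - x b| <= D) -> connect e v w ->
  `|x v - x w| <= #|T|%:R * D.
Proof.
move=> D0 xD /connectP[p vp ->]; case/shortenP: vp => q vq q_uniq _.
apply: le_trans (path_dist_le xD vq) _.
rewrite ler_wpM2r// ler_nat; apply/ltnW.
by rewrite -[X in (X <= _)%N]/(size (v :: q)) -(card_uniqP q_uniq) max_card.
Qed.

Variable d : T -> T -> R.

(** Nonnegative, and zero exactly when [x] realizes all the lengths [d]; a
    sum keeps it continuous in [x]. *)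
Definition distance_defect (x : T -> X) : R :=
  \sum_v \sum_(w | e v w) `| `|x v - x w| - d v w|.

Lemma distance_defect_continuous :
  continuous (distance_defect : prod_topology (fun _ : T => X) -> R).
Proof.
pose P := prod_topology (fun _ : T => X).
apply: (@continuous_big R _ +%R 0 xpredT _ P) => [|v _].
  exact: add_continuous.
apply: (@continuous_big R _ +%R 0 (e v) _ P) => [|w _ x].
  exact: add_continuous.
have proj u : (y : P) u @[y --> x] --> x u.
  exact: (@proj_continuous _ (fun _ : T => X) u x).
have dist : `|(y : P) v - y w| @[y --> x] --> `|x v - x w|.
  exact: (cvg_norm (cvgB (proj v) (proj w))).
exact: (cvg_norm (cvgB dist (cvg_cst (d v w)))).
Qed.

(** The components of ever better approximate realizations may drift to
    infinity. Subtracting from each [x v] the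
    position of the root of its component changes no edge length and confines
    [x] to a compact set, on which the defect attains its infimum, zero. *)
Lemma distance_realization : symmetric e ->
  (forall r : R, compact [set x : X | `|x| <= r]) ->
  (forall eps : R, 0 < eps -> exists x : T -> X,
    forall v w, e v w -> `| `|x v - x w| - d v w| <= eps) ->
  exists x : T -> X, forall v w, e v w -> `|x v - x w| = d v w.
Proof.
move=> e_sym ballX approx.
(* The 1 absorbs the error of any realization up to eps <= 1. *)
pose D : R := 1 + \sum_v \sum_w `|d v w|.
have D0 : 0 <= D by rewrite addr_ge0// sumr_ge0// => v _; exact: sumr_ge0.
have dD v w : d v w + 1 <= D.
  rewrite addrC lerD2l (le_trans (ler_norm _))// (bigD1 v)//= (bigD1 w)//=.
  by rewrite -addrA lerDl addr_ge0// !sumr_ge0// => a _; exact: sumr_ge0.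
pose P := prod_topology (fun _ : T => X).
pose K : set P := [set x | forall v, `|x v| <= #|T|%:R * D].
have Kcompact : compact K.
  exact: (@tychonoff _ (fun _ : T => X)
    (fun=> [set x : X | `|x| <= #|T|%:R * D])).
have approxK eps : 0 < eps -> eps <= 1 -> exists2 x, K x &
    forall v w, e v w -> `| `|x v - x w| - d v w| <= eps.
  move=> eps0 eps1; have [x xd] := approx _ eps0.
  have xD v w : e v w -> `|x v - x w| <= D.
    move=> /xd/(le_trans (ler_norm _)); rewrite lerBlDr => /le_trans; apply.
    by rewrite addrC (le_trans _ (dD v w))// lerD2l.
  exists (fun v => x v - x (fingraph.root e v)) => [v|v w vw].
    by apply: connect_dist_le => //; exact: connect_root.
  have -> : fingraph.root e v = fingraph.root e w.
    by apply/(fingraph.rootP (sym_connect_sym e_sym))/connect1.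
  by rewrite opprB addrA subrK; exact: xd.
have [||c Kc cmin] := @compact_EVT_min P R distance_defect K _ Kcompact.
- by have [x Kx _] := approxK 1 ltr01 (lexx _); exists x.
- by apply: continuous_subspaceT => x; exact: distance_defect_continuous.
have dist_ge0 (x : T -> X) v w : 0 <= `| `|x v - x w| - d v w| by [].
have sum_ge0 (x : T -> X) v :
  0 <= \sum_(w | e v w) `| `|x v - x w| - d v w| by exact: sumr_ge0.
have defect0 : distance_defect c = 0.
  apply/eqP; rewrite eq_le sumr_ge0// andbT; apply/ler_addgt0Pl => eps eps0.
  rewrite addr0; pose N : R := \sum_v \sum_(w | e v w) 1.
  have N0 : 0 <= N by rewrite sumr_ge0// => v _; exact: sumr_ge0.
  (* N counts the terms of the defect; N + 1 avoids dividing by zero. *)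
  pose delta := Num.min 1 (eps / (N + 1)).
  have [||x Kx xd] := approxK delta.
  - by rewrite lt_min ltr01 divr_gt0// ltr_wpDl.
  - by rewrite ge_min lexx.
  apply: le_trans (cmin x (mem_set Kx)) _.
  have : distance_defect x <= delta * N.
    rewrite mulr_sumr ler_sum// => v _; rewrite mulr_sumr ler_sum// => w vw.
    by rewrite mulr1 xd.
  move=> /le_trans; apply; apply: (@le_trans _ _ (eps / (N + 1) * (N + 1))).
    rewrite ler_pM// ?ge_min ?lexx ?orbT ?lerDl//.
    by rewrite le_min ler01 divr_ge0// ?ltW// ltr_wpDl.
  by rewrite divfK// gt_eqF// ltr_wpDl.
exists c => v w vw; apply/eqP; rewrite -subr_eq0 -normr_eq0; apply/eqP.
have cv0 : \sum_(a | e v a) `| `|c v - c a| - d v a| = 0.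
  by apply: (psumr_eq0P _ defect0).
by apply: (psumr_eq0P _ cv0).
Qed.

End distance_realization.

(** * Norms of truncated sequences *)

Section truncated_norm.
Variable R : realType.
Implicit Types (p q : \bar R) (u : nat -> R).

Lemma cvg_powR (I : Type) (F : set_system I) (FF : Filter F)
    (f g : I -> R) (a b : R) : 0 < a ->
  f i @[i --> F] --> a -> g i @[i --> F] --> b ->
  f i `^ g i @[i --> F] --> a `^ b.
Proof.
move=> a0 fa gb; rewrite /powR gt_eqF//.
have : expR (g i * ln (f i)) @[i --> F] --> expR (b * ln a).
  have ln_cvg : ln (f i) @[i --> F] --> ln a.
    by apply: cvg_comp fa _; exact: continuous_ln.
  apply: cvg_comp (cvgM gb ln_cvg) _; exact: continuous_expR.
apply: cvg_trans; apply: near_eq_cvg.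
have f_gt0 : \forall i \near F, 0 < f i by exact: (cvgr_gt _ fa).
by apply: filterS f_gt0 => i fi0; rewrite gt_eqF.
Qed.

(** The [l_q] norm of the first [n] terms of [u]. It takes bare sequences and not
    elements of [lp], whose type depends on [q], so that a limit in [q] makes
    sense. *)
Definition trunc_norm q n u : R :=
  if q is r%:E then (\sum_(k < n) `|u k| `^ r) `^ r^-1
  else \big[Num.max/0]_(k < n) `|u k|.

Lemma eq_trunc_norm q n u v : (forall k, (k < n)%N -> u k = v k) ->
  trunc_norm q n u = trunc_norm q n v.
Proof.
move=> uv; rewrite /trunc_norm.
by case: q => [r||]; [congr (_ `^ _)| |]; apply: eq_bigr => k _; rewrite uv.
Qed.

Lemma trunc_norm0 q n u : (1 <= q)%E -> (forall k, (k < n)%N -> u k = 0) ->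
  trunc_norm q n u = 0.
Proof.
case: q => [r||] // r1 u0; last first.
  by rewrite /= big1_idem/= ?maxxx// => k _; rewrite u0// normr0.
have r0 : r != 0 by rewrite gt_eqF// (lt_le_trans ltr01).
rewrite /= big1 ?powR0 ?invr_eq0// => k _.
by rewrite u0// normr0 powR0.
Qed.

Lemma le_trunc_norm_pinfty n u k : (k < n)%N -> `|u k| <= trunc_norm +oo n u.
Proof.
by move=> kn; apply: (le_bigmax 0 (fun i : 'I_n => `|u i|) (Ordinal kn)).
Qed.

Lemma trunc_norm_pinfty_ge0 n u : 0 <= trunc_norm +oo n u.
Proof. exact: bigmax_ge_id. Qed.

Lemma lp_coord_le (oo1 : (1 <= +oo :> \bar R)%E) (x : lp oo1) k :
  `|x k| <= `|x|.
Proof.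
by rewrite -lee_fin lp_norm_pinfty; apply: ereal_sup_ubound; exists k.
Qed.

Lemma Lnorm_finite_support q n u : (1 <= q)%E ->
  (forall k, (n <= k)%N -> u k = 0) ->
  'N[@counting nat R]_q [EFin \o u]%E = (trunc_norm q n u)%:E.
Proof.
move=> q1 u0; case: q q1 => [r||] // r1.
  have r0 : 0 < r by exact: (lt_le_trans ltr01).
  rewrite Lnorm_counting// (nneseries_split 0 n) => [|k _]; last first.
    exact: poweR_ge0.
  rewrite add0n eseries0 => [|k nk _]; last first.
    by rewrite /= u0// normr0 powR0// gt_eqF.
  by rewrite adde0 big_mkord /= sumEFin poweR_EFin.
have counting_gt0 : (0 < @counting nat R setT)%E.
  by rewrite /counting asboolF//; exact: infinite_nat.
rewrite unlock counting_gt0; apply/eqP; rewrite eq_le; apply/andP; split.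
  apply/ess_supP/nearW => k; rewrite /= lee_fin.
  have [nk|kn] := leqP n k; last exact: le_trunc_norm_pinfty.
  by rewrite u0// normr0 trunc_norm_pinfty_ge0.
have coord_le k :
    (`|u k|%:E <= ess_sup (@counting nat R) (fun k => `|u k|%:E))%E.
  exact: (ae_counting (ess_sup_ge _ (fun k => `|u k|%:E)%E)).
rewrite /trunc_norm; elim/big_ind: _ => [|a b ha hb|k _]; last exact: coord_le.
  by apply: le_trans (coord_le 0%N); rewrite lee_fin.
by rewrite EFin_max ge_max ha hb.
Qed.

Lemma lp_norm_trunc q (q1 : (1 <= q)%E) (x : lp q1) n :
  (forall k, (n <= k)%N -> x k = 0) -> `|x| = trunc_norm q n x.
Proof.
by move=> x0; rewrite [LHS]/(lp_norm x)/lp_norm (Lnorm_finite_support q1 x0).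
Qed.

Lemma lp_trunc q (q1 : (1 <= q)%E) n u :
  exists x : lp q1, x =1 (fun k => if (k < n)%N then u k else 0).
Proof.
apply: mem_lp; rewrite (Lnorm_finite_support (n := n)) ?ltry// => k nk.
by rewrite ltnNge nk.
Qed.

(** Partial sums of [`|x k| `^ r], or the partial maxima when [p = +oo],
    converge to their supremum. *)
Lemma cvg_trunc_norm p (p1 : (1 <= p)%E) (x : lp p1) :
  trunc_norm p n x @[n --> \oo] --> `|x|.
Proof.
case: p p1 x => [r||] // p1 x.
  have r0 : 0 < r by exact: (lt_le_trans ltr01).
  (* The map [s |-> s `^ r^-1] is handled by [cvg_powR] only for [s > 0]. *)
  have [x0|xN0] := eqVneq x 0.
    have -> : (fun n => trunc_norm r%:E n x) = cst 0.
      by apply/funext => n; apply: trunc_norm0 => // k _; rewrite x0.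
    by rewrite x0 normr0; exact: cvg_cst.
  pose S := (\sum_(k <oo) (`|x k| `^ r)%:E)%E.
  have S_cvg : (\sum_(0 <= k < n) (`|x k| `^ r)%:E)%E @[n --> \oo] --> S.
    by apply: is_cvg_nneseries => k _ _; rewrite lee_fin powR_ge0.
  have normS := lp_norm_fin x; rewrite -/S in normS.
  have S_ge0 : (0 <= S)%E.
    by apply: nneseries_ge0 => k _ _; rewrite lee_fin powR_ge0.
  have S_fin : S \is a fin_num.
    rewrite ge0_fin_numE//; apply: (@lty_poweRy _ _ r^-1).
      by rewrite invr_eq0 gt_eqF.
    by rewrite -normS ltry.
  move: S_cvg normS; rewrite -(fineK S_fin) poweR_EFin => S_cvg [normS].
  rewrite normS /trunc_norm; apply: cvg_powR; last exact: cvg_cst.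
    rewrite lt_neqAle fine_ge0// andbT; apply: contraNneq xN0 => S0.
    by rewrite -normr_eq0 normS -S0 powR0// invr_eq0 gt_eqF.
  move: S_cvg => /fine_cvgP[_].
  apply: cvg_trans; apply: near_eq_cvg; near=> n.
  by rewrite /= sumEFin big_mkord.
apply/cvgrPdist_le => e e0.
have [|_ [k _ <-] ke] :=
  @ub_ereal_sup_adherent _ (range (fun k => `|x k|%:E)) e e0.
  by rewrite -lp_norm_pinfty.
rewrite -lp_norm_pinfty lte_fin in ke.
near=> n; rewrite ger0_norm ?subr_ge0; last first.
  by apply: bigmax_le => // i _; exact: lp_coord_le.
rewrite lerBlDl -lerBlDr; apply/(le_trans (ltW ke))/le_trunc_norm_pinfty.
by near: n; exists k.+1.
Unshelve. all: by end_near. Qed.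

Lemma powRrK (r a : R) : 0 < r -> 0 <= a -> (a `^ r) `^ r^-1 = a.
Proof. by move=> r0 a0; rewrite -powRrM mulfV ?gt_eqF// powRr1. Qed.

Lemma trunc_norm_pinfty_le (r : R) n u : 1 <= r ->
  trunc_norm +oo n u <= trunc_norm r%:E n u.
Proof.
move=> r1; have r0 : 0 < r by exact: lt_le_trans r1.
apply: bigmax_le => [|k _]; first exact: powR_ge0.
rewrite -[leLHS](powRrK r0)//.
have sum_ge0 (P : pred 'I_n) : 0 <= \sum_(i < n | P i) `|u i| `^ r.
  by rewrite sumr_ge0// => i _; exact: powR_ge0.
rewrite ge0_ler_powR ?invr_ge0 ?(ltW r0)// ?nnegrE ?powR_ge0//.
by rewrite (bigD1 k)//= lerDl.
Qed.

Lemma trunc_norm_le_pinfty (r : R) n u : 1 <= r ->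
  trunc_norm r%:E n u <= n%:R `^ r^-1 * trunc_norm +oo n u.
Proof.
move=> r1; have r0 : 0 < r by exact: lt_le_trans r1.
have M0 := trunc_norm_pinfty_ge0 n u.
rewrite -[X in _ * X](powRrK r0)// -powRM ?ler0n ?powR_ge0//.
have sum_ge0 : 0 <= \sum_(k < n) `|u k| `^ r.
  by rewrite sumr_ge0// => k _; exact: powR_ge0.
rewrite ge0_ler_powR ?invr_ge0 ?(ltW r0)// ?nnegrE ?mulr_ge0 ?powR_ge0//.
rewrite mulr_natl -[X in _ *+ X]card_ord -sumr_const ler_sum// => k _.
by rewrite ge0_ler_powR ?(ltW r0)// ?nnegrE// le_trunc_norm_pinfty.
Qed.

(** For real [p] this is the continuity of real powers. At [+oo] the norm lies
    between [M] and [n%:R `^ q^-1 * M], where [M] is the maximum of the terms,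
    and [n%:R `^ q^-1] tends to 1. *)
Lemma cvg_trunc_norm_exponent p n u : (1 <= p)%E ->
  trunc_norm q n u @[q --> within (exponents R) (nbhs p)] --> trunc_norm p n u.
Proof.
move=> p1; apply/cvgrPdist_le => e e0; rewrite near_withinE.
(* A term [u k != 0] makes the sum of powers positive, as [cvg_powR] needs. *)
have [u0|] := pselect (forall k, (k < n)%N -> u k = 0).
  by apply: nearW => q q1; rewrite !trunc_norm0// subrr normr0 ltW.
move=> /existsNP[k /not_implyP[kn /eqP uk0]].
have n0 : (0 < n)%N by exact: leq_ltn_trans kn.
case: p p1 => [r||] // r1.
  have r0 : 0 < r by exact: (lt_le_trans ltr01).
  have : trunc_norm s%:E n u @[s --> r] --> trunc_norm r%:E n u.
    rewrite /trunc_norm; apply: cvg_powR.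
    - rewrite (bigD1 (Ordinal kn))//= ltr_wpDr//.
        by rewrite sumr_ge0// => i _; exact: powR_ge0.
      by rewrite powR_gt0 ?normr_gt0.
    - apply: cvg_big => [|i _]; first exact: add_continuous.
      have [ui0|uiN0] := eqVneq (u i) 0; last first.
        by apply: cvg_powR; rewrite ?normr_gt0//; exact: cvg_cst.
      rewrite ui0 normr0 powR0 ?gt_eqF//.
      apply: cvg_near_cst; near=> s; apply: powR0; rewrite gt_eqF//.
      near: s; exact: lt_nbhsr.
    - by apply: cvgV; [rewrite gt_eqF|exact: cvg_id].
  move=> /cvgrPdist_le/(_ e e0) r_near.
  by apply/nbhs_EFin; apply: filterS r_near.
have : trunc_norm s%:E n u @[s --> +oo] --> trunc_norm +oo n u.
  apply: (@squeeze_cvgr _ _ _ _ (cst (trunc_norm +oo n u))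
      (fun s => n%:R `^ s^-1 * trunc_norm +oo n u)).
  - near=> s; have s1 : 1 <= s by near: s; exact: nbhs_pinfty_ge.
    by rewrite /= trunc_norm_pinfty_le// trunc_norm_le_pinfty.
  - exact: cvg_cst.
  - have inv_cvg : s^-1 @[s --> +oo] --> (0 : R).
      by apply/(@gtr0_cvgV0 R R +oo _ id) => //; exact: nbhs_pinfty_gt.
    have pow_cvg : n%:R `^ s^-1 @[s --> +oo] --> (1 : R).
      rewrite -[X in _ --> X](powRr0 n%:R).
      apply: (@cvg_powR _ +oo _ (fun=> n%:R)); rewrite ?ltr0n//.
      exact: cvg_cst.
    by rewrite -[X in _ --> X]mul1r; exact: cvgMr_tmp.
move=> /cvgrPdist_le/(_ e e0)[M [_ M_near]].
exists M; split=> [|[s|_ _|//]]; first exact: num_real.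
  by move=> Ms _; exact: M_near.
by rewrite subrr normr0 ltW.
Unshelve. all: by end_near. Qed.

End truncated_norm.

(** * Closedness of the set of exponents *)

(** The adherence of [p] is phrased with filters on the extended reals, so that
    [p] keeps its own neighborhoods instead of those of the subspace. *)
Lemma adherent_flattenable_exponent (R : realType) (G : graph)
    (X : normedModType R) (p : \bar R) : finite_dimensional X -> (1 <= p)%E ->
  (forall P : set (\bar R),
    (\forall q \near within (exponents R) (nbhs p), P q) ->
    exists2 q, flattenable_exponents G X q & P q) ->
  flattenable_exponents G X p.
Proof.
move=> Xfin p1 adh; exists p1; apply/flattenableP => y.
apply: (distance_realization (d := fun v w => `|y v - y w|)).
- exact: adj_sym.
- by move=> r; exact: finite_dimensional_compact_ball.
move=> e e0; have e20 : 0 < e / 2 by exact: divr_gt0.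
have [n yn] : exists n, forall v w,
    `| `|y v - y w| - trunc_norm p n (y v - y w)| <= e / 2.
  suff : \forall n \near \oo, forall v w,
      `| `|y v - y w| - trunc_norm p n (y v - y w)| <= e / 2.
    by move=> /filter_ex.
  apply: filter_forall => v; apply: filter_forall => w.
  by have /cvgrPdist_le/(_ _ e20) := @cvg_trunc_norm _ _ p1 (y v - y w).
have [q [q1 Xq] yq] : exists2 q, flattenable_exponents G X q & forall v w,
    `|trunc_norm p n (y v - y w) - trunc_norm q n (y v - y w)| <= e / 2.
  apply: adh; apply: filter_forall => v; apply: filter_forall => w.
  by have /cvgrPdist_le/(_ _ e20) :=
    @cvg_trunc_norm_exponent R p n (y v - y w) p1.
(* The cut-offs of the vectors of [y], seen in [l_q]. *)
have /choice[z zy] v := lp_trunc q1 n (y v).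
have /flattenableP/(_ z)[x xz] := Xq.
exists x => v w vw; rewrite xz//.
have -> : `|z v - z w| = trunc_norm q n (y v - y w).
  have zB k : (z v - z w) k = z v k - z w k by [].
  have yB k : (y v - y w) k = y v k - y w k by [].
  rewrite (@lp_norm_trunc _ _ _ _ n) => [|k nk]; last first.
    by rewrite zB !zy ltnNge nk subrr.
  by apply: eq_trunc_norm => k kn; rewrite zB yB !zy kn.
rewrite distrC (splitr e) -(subrKA (trunc_norm p n (y v - y w))).
exact: le_trans (ler_normD _ _) (lerD (yn v w) (yq v w)).
Qed.

Theorem proposition5p6 (R : realType) (G : graph) (X : normedModType R)
    (Xfin : finite_dimensional X) :
  closed (flattenable_exponents G X : set (subspace (exponents R))).
Proof.
move=> p clp; have [p1|Np1] := pselect (exponents R p); last first.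
  (* The topology of a subspace makes every outside point isolated. *)
  have p_isolated : nbhs (p : subspace (exponents R)) [set p].
    by case: (@nbhs_subspaceP _ (exponents R) p) => // _ q.
  by have [q [Eq <-]] := clp _ p_isolated.
apply: adherent_flattenable_exponent => // P Pp.
have p_near : nbhs (p : subspace (exponents R)) P.
  by case: (@nbhs_subspaceP _ (exponents R) p).
by have [q [Eq Pq]] := clp _ p_near; exists q.
Qed.
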